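(* For each $n\ge1$ and each partition $\lambda\vdash n$, $$\omega_n(C_\lambda)=\begin{cases}(-1)^{a+1}\,\dfrac{\phi(b)}{n}&\text{if }\lambda=[b^a]\text{ for a factorization } n=ab,\\[1ex] 0&\text{otherwise,}\end{cases}$$ where $\phi$ is Euler's totient function. The measure $\omega_n$ is supported on exactly $d(n)$ conjugacy classes, where $d(n)$ is the number of positive divisors of $n$. It is a nonnegative measure for odd $n$ and is a strictly signed measure (taking both positive and negative values) for even $n$.
   Context: A partition $\lambda\vdash n$ is written $[n^{m_n},\dots,2^{m_2},1^{m_1}]$, where $m_j=m_j(\lambda)$ is the number of parts equal to $j$. $C_\lambda\subset S_n$ is the conjugacy class of permutations of cycle type $\lambda$. For a function $f$ on $S_n$ and $Y\subseteq S_n$, $f(Y):=\sum_{g\in Y}f(g)$. The $m$-th necklace polynomial is $M_m(X)=\frac1m\sum_{d\mid m}\mu(d)X^{m/d}$. The cycle polynomial of $\lambda\vdash n$ is $N_\lambda(X)=\prod_{j=1}^n\binom{M_j(X)}{m_j(\lambda)}$, where $\binom{t}{k}=\frac{t(t-1)\cdots(t-k+1)}{k!}$. For $n\ge 2$ every $N_\lambda(X)$ is divisible by $X-1$, and the $1$-splitting measure on $S_n$ is the class function with $\nu_{n,1}^{\ast}(C_\lambda)=\left.\frac{N_\lambda(X)}{X^{n-1}(X-1)}\right|_{X=1}$. The measures $\omega_n$ on $S_n$ ($n\ge1$) are the class functions defined recursively by $\omega_1(C_{[1]})=1$ and, for $n\ge2$: $\omega_n(C_\lambda)=\nu_{n,1}^{\ast}(C_\lambda)$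 if $\lambda=[b^a]$ with $ab=n$ and $b>1$; $\omega_n(C_{[1^n]})=\nu_{n,1}^{\ast}(C_{[1^n]})-\omega_{n-1}(C_{[1^{n-1}]})$; and $\omega_n(C_\lambda)=0$ for all other $\lambda$. *)

(* Defs.v *)
From mathcomp Require Export all_boot all_order all_algebra all_fingroup.

Set Implicit Arguments.
Unset Strict Implicit.
Unset Printing Implicit Defensive.

Import GRing.Theory Num.Theory.
Local Open Scope ring_scope.

Definition is_intpart (n : nat) (la : seq nat) : bool :=
  [&& sorted geq la, 0%N \notin la & sumn la == n].

Definition cycle_type (n : nat) (g : 'S_n) : seq nat :=
  sort geq [seq #|c| | c : {set 'I_n} <- enum (porbits g)].

(* C_lambda *)
Definition cycle_class (n : nat) (la : seq nat) : {set 'S_n} :=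
  [set g | cycle_type g == la].

(* f(Y) *)
Definition measure_of (n : nat) (f : {ffun 'S_n -> rat}) (Y : {set 'S_n}) : rat :=
  \sum_(g in Y) f g.

(* The class function on S_n whose total mass on C_lambda is w lambda, for
   every partition lambda of n; note that w gives masses of whole classes,
   not values at single permutations. *)
Definition class_fun_of_masses (n : nat) (w : seq nat -> rat) :
    {ffun 'S_n -> rat} :=
  [ffun g => w (cycle_type g) / #|cycle_class n (cycle_type g)|%:R].

(* The Moebius function, for d > 0. *)
Definition moebius (d : nat) : rat :=
  if all (fun p => logn p d == 1%N) (primes d)
  then (-1) ^+ size (primes d) else 0.

Definition necklace_poly (m : nat) : {poly rat} :=
  m%:R^-1 *: \sum_(d <- divisors m) moebius d *: 'X^(m %/ d).

Definition binom_poly (t : {poly rat}) (k : nat) : {poly rat} :=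
  k`!%:R^-1 *: \prod_(i < k) (t - i%:R).

Definition cycle_poly (n : nat) (la : seq nat) : {poly rat} :=
  \prod_(1 <= j < n.+1) binom_poly (necklace_poly j) (count_mem j la).

(* The value at X = 1 of the rational function N_lambda / (X^(n-1) (X - 1)),
   for n >= 2: the factor X - 1 divides N_lambda and is cancelled exactly, while
   X^(n-1) need not divide N_lambda and is evaluated separately. *)
Definition splitting_mass (n : nat) (la : seq nat) : rat :=
  (cycle_poly n la %/ ('X - 1)).[1] / ('X^(n.-1)).[1].

(* nu*_{n,1} *)
Definition splitting_measure (n : nat) : {ffun 'S_n -> rat} :=
  class_fun_of_masses n (splitting_mass n).

(* lambda = [b^a] for some factorization n = ab with b > 1 *)
Definition is_nontrivial_rect (n : nat) (la : seq nat) : bool :=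
  has (fun b => (1 < b)%N && (la == nseq (n %/ b) b)) (divisors n).

(* The value at n = 0 is a placeholder. *)
Fixpoint omega (n : nat) : {ffun 'S_n -> rat} :=
  match n return {ffun 'S_n -> rat} with
  | 0 => [ffun=> 0]
  | n'.+1 =>
    class_fun_of_masses n'.+1 (fun la =>
      if n' == 0%N then 1
      else if is_nontrivial_rect n'.+1 la then
        measure_of (splitting_measure n'.+1) (cycle_class n'.+1 la)
      else if la == nseq n'.+1 1%N then
        measure_of (splitting_measure n'.+1) (cycle_class n'.+1 la)
        - measure_of (omega n') (cycle_class n' (nseq n' 1%N))
      else 0)
  end.

(* The conjugacy classes of S_n that carry some mass of f. *)
Definition support_classes (n : nat) (f : {ffun 'S_n -> rat}) :
    {set {set 'S_n}} :=
  [set C in classes [set: 'S_n] | [exists g in C, f g != 0]].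

(* Main.v *)
Require Import Defs.
From mathcomp Require Import all_solvable ring.

(** Each omega_n is determined by its masses on the conjugacy classes, so the
    theorem is a computation of those masses followed by a count of classes.

    For lambda = [b^a] the cycle polynomial is the single binomial
    binom(M_b, a).  If b > 1, then M_b vanishes at 1, because the sum of mu(d)
    over d | b is 0; hence dividing binom(M_b, a) by X - 1 and evaluating at 1
    gives its derivative there, in which only the factor M_b is differentiated:
    M_b'(1) * (-1)(-2)...(-(a-1)) / a! = (-1)^(a-1) M_b'(1) / a.  Finally
    M_b'(1) = phi(b) / b by Moebius inversion of the totient, which gives
    (-1)^(a+1) phi(b) / n ([splitting_mass_rect]).  If b = 1, the polynomial is
    binom(X, n); now it is the factor X - 1 that vanishes, and the value is
    (-1)^n / (n (n - 1)) ([splitting_mass_id]).  Subtracting the inductive value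
    (-1)^n / (n - 1) of omega_{n-1} leaves (-1)^(n+1) / n, which is the formula
    for b = 1 ([omegaE]).

    These are masses of classes, so the computation says something about omega_n
    only because every rectangle [b^a] is the cycle type of some permutation
    ([cycle_type_rect_exists]: a translation of Z/n).  Counting the support also
    needs that a set of permutations with a given cycle type is one conjugacy
    class ([cycle_class_conj]); the classes in the support then correspond to the
    rectangles with n cells, that is, to the divisors b of n, as phi(b) > 0.  The
    sign (-1)^(a+1) is positive for odd a; every a dividing an odd n is odd, and
    for even n the rectangles [n^1] and [1^n] have opposite signs. *)

Set Implicit Arguments.
Unset Strict Implicit.
Unset Printing Implicit Defensive.

(** * Cycle types and conjugacy *)

Section CycleTypes.
Local Open Scope group_scope.

Lemma geq_total : total geq.
Proof. by move=> x y; exact: leq_total. Qed.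
Lemma geq_trans : transitive geq.
Proof. by move=> x y z xy /leq_trans; apply. Qed.
Lemma geq_anti : antisymmetric geq.
Proof. by move=> x y; rewrite andbC => /anti_leq. Qed.

Lemma porbits_partition (T : finType) (s : {perm T}) :
  partition (porbits s) [set: T].
Proof.
rewrite /porbits porbitE.
have -> : orbit 'P <[s]> @: T = orbit 'P <[s]> @: [set: T].
  by apply/setP => C; apply/imsetP/imsetP => -[x _ ->]; exists x.
by apply: orbit_partition; apply/actsP => u _ x; rewrite !inE.
Qed.

Lemma mem_cycle_type n (s : 'S_n) k :
  reflect (exists x, k = #|porbit s x|) (k \in cycle_type s).
Proof.
rewrite mem_sort; apply: (iffP mapP) => [[C]|[x ->]].
  by rewrite mem_enum => /imsetP[x _ ->] ->; exists x.
by exists (porbit s x); rewrite ?mem_enum ?imset_f.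
Qed.

Lemma cycle_type_is_intpart n (s : 'S_n) : is_intpart n (cycle_type s).
Proof.
apply/and3P; split.
- exact: sort_sorted geq_total _.
- apply/mem_cycle_type => -[x /esym/eqP].
  by rewrite (negPf (card_porbit_neq0 s x)).
rewrite sumnE /cycle_type (perm_big _ (permEl (perm_sort _ _))).
rewrite big_map big_enum /=.
by rewrite -(card_partition (porbits_partition s)) cardsT card_ord.
Qed.

(** Conjugation by h relabels the points by h, so it carries cycles to cycles;
    this is why cycle types are invariant under conjugation. *)
Lemma porbitJ (T : finType) (s h : {perm T}) x :
  porbit (s ^ h) (h x) = h @: porbit s x.
Proof.
apply/setP => y; apply/porbitP/imsetP => [[i ->]|[_ /porbitP[i ->] ->]].
  by exists ((s ^+ i) x); rewrite ?mem_porbit // -conjXg permJ.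
by exists i; rewrite -conjXg permJ.
Qed.

Lemma cycle_typeJ n (s h : 'S_n) : cycle_type (s ^ h) = cycle_type s.
Proof.
have h_inj : injective (fun C : {set 'I_n} => h @: C).
  exact: imset_inj perm_inj.
apply/(perm_sortP geq_total geq_trans geq_anti).
have /(perm_map (fun C : {set 'I_n} => #|C|)) /permPl-> :
    perm_eq (enum (porbits (s ^ h))) [seq h @: C | C : {set 'I_n} in porbits s].
  apply: uniq_perm; rewrite ?enum_uniq ?map_inj_uniq ?enum_uniq // => D.
  rewrite mem_enum; apply/imsetP/imageP => [[x _ ->]|[_ /imsetP[x _ ->] ->]].
    by exists (porbit s (h^-1 x)); rewrite ?imset_f // -porbitJ permKV.
  by exists (h x); rewrite ?porbitJ.
rewrite -map_comp; apply/seq.permP => P; congr (count _ _); apply: eq_map => C /=.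
by rewrite card_imset //; exact: perm_inj.
Qed.

(** A cycle of length c is a copy of Z/c: the position of a point on it is an
    exponent modulo c.  This makes a map defined along cycles well defined, and
    also injective, as soon as it respects cycle lengths. *)
Lemma eq_expg_porbit (T : finType) (s : {perm T}) x k l :
  ((s ^+ k) x == (s ^+ l) x) = (k == l %[mod #|porbit s x|]).
Proof.
have c_gt0 : 0 < #|porbit s x| by rewrite lt0n card_porbit_neq0.
have red j : (s ^+ j) x = nth x (traject s x #|porbit s x|) (j %% #|porbit s x|).
  rewrite nth_traject ?ltn_mod // permX {1}(divn_eq j #|porbit s x|) addnC iterD.
  congr iter; elim: (j %/ _) => // q IHq.
  by rewrite mulSn iterD IHq iter_porbit.
by rewrite !red nth_uniq ?size_traject ?ltn_mod // uniq_traject_porbit.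
Qed.

(** Sorting the cycles of s and of t by length pairs them off with equal lengths.
    After choosing a starting point on every cycle, the map sending the k-th
    iterate of a starting point for s to the k-th iterate of the corresponding
    starting point for t conjugates s into t. *)
Lemma eq_cycle_type_conj n (s t : 'S_n) :
  cycle_type s = cycle_type t -> exists h, t = s ^ h.
Proof.
case: n s t => [|n] s t.
  (* There are no points, hence a single permutation. *)
  by exists 1; apply/permP => -[].
pose geq_card := relpre (fun C : {set 'I_n.+1} => #|C|) geq.
rewrite /cycle_type !sort_map -/geq_card.
set Ls := sort _ _; set Lt := sort _ _ => eq_card.
have eq_sz : size Ls = size Lt by have := congr1 size eq_card; rewrite !size_map.
have memLs C : (C \in Ls) = (C \in porbits s) by rewrite mem_sort mem_enum.
have memLt C : (C \in Lt) = (C \in porbits t) by rewrite mem_sort mem_enum.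
have uniqLt : uniq Lt by rewrite sort_uniq enum_uniq.
(* The pairing of the cycles of s with the cycles of t. *)
pose phi C := nth set0 Lt (index C Ls).
have lt_phi C : C \in porbits s -> index C Ls < size Lt.
  by rewrite -memLs -index_mem eq_sz.
have phi_in C : C \in porbits s -> phi C \in porbits t.
  by move=> /lt_phi Cs; rewrite -memLt mem_nth.
have card_phi C : C \in porbits s -> #|phi C| = #|C|.
  move=> Cs; rewrite -(nth_map _ 0 (fun C : {set _} => #|C|)) ?lt_phi //.
  by rewrite -eq_card (nth_map set0) ?nth_index ?memLs // index_mem memLs.
have phi_inj : {in porbits s &, injective phi}.
  move=> C D Cs Ds /eqP; rewrite nth_uniq ?lt_phi // => /eqP.
  by apply: (index_inj set0); rewrite memLs.
(* The starting point: a point of C, as cycles are not empty. *)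
pose rep (C : {set 'I_n.+1}) := odflt ord0 [pick x in C].
have porbit_rep u C : C \in porbits u -> porbit u (rep C) = C.
  case/imsetP=> x _ ->; apply/eqP; rewrite eq_porbit_mem /rep.
  by case: pickP => [//|/(_ x)]; rewrite porbit_id.
have card_rep C : C \in porbits s -> #|C| = #|porbit s (rep C)|.
  by move=> Cs; rewrite porbit_rep.
pose h x := let C := porbit s x in
  (t ^+ index x (traject s (rep C) #|C|)) (rep (phi C)).
(* The index picked by h is only congruent to k modulo the length of C, which
   suffices because phi C has the same length. *)
have hE C k : C \in porbits s -> h ((s ^+ k) (rep C)) = (t ^+ k) (rep (phi C)).
  move=> Cs; rewrite /h porbit_perm porbit_rep //; apply/eqP.
  set i := index _ _; rewrite eq_expg_porbit porbit_rep ?phi_in // card_phi //.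
  rewrite card_rep // -eq_expg_porbit.
  have: (s ^+ k) (rep C) \in traject s (rep C) #|C|.
    by rewrite card_rep // -porbit_traject mem_porbit.
  move=> in_tr; have lt_i : i < #|C|.
    by rewrite -[X in _ < X](size_traject s (rep C)) index_mem.
  by rewrite permX -(nth_traject s lt_i) nth_index.
have repP x : exists2 C, C \in porbits s & exists k, x = (s ^+ k) (rep C).
  exists (porbit s x); first exact: imset_f.
  by apply/porbitP; rewrite porbit_rep ?porbit_id ?imset_f.
have h_inj : injective h.
  move=> x y; have [C Cs [k ->]] := repP x; have [D Ds [l ->]] := repP y.
  rewrite !hE // => eq_t; have eqCD : C = D.
    apply: phi_inj => //; rewrite -(porbit_rep _ _ (phi_in _ Cs)).
    by rewrite -(porbit_rep _ _ (phi_in _ Ds)) -(porbit_perm _ k) eq_t porbit_perm.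
  rewrite -{}eqCD in eq_t *; move/eqP: eq_t; rewrite eq_expg_porbit.
  rewrite porbit_rep ?phi_in // card_phi // card_rep //.
  by rewrite -eq_expg_porbit => /eqP.
exists (perm h_inj); apply/permP => y; rewrite -[y](permKV (perm h_inj)).
set x := _ y; rewrite permJ !permE; have [C Cs [k ->]] := repP x.
by rewrite -permM -expgSr !hE // expgSr permM.
Qed.

Lemma cycle_class_conj n (s : 'S_n) :
  cycle_class n (cycle_type s) = s ^: [set: 'S_n].
Proof.
apply/setP => t; rewrite inE; apply/eqP/imsetP => [/esym|[h _ ->]].
  by case/eq_cycle_type_conj=> h ->; exists h.
exact: cycle_typeJ.
Qed.

(** Translation by x in a finite group is a source of permutations whose cycles
    all have the same length: they are the left cosets of <[x]>. *)
Lemma porbit_mulr (gT : finGroupType) (x y : gT) :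
  porbit (perm (mulIg x)) y = y *: <[x]>.
Proof.
have mulX i : (perm (mulIg x) ^+ i) y = y * x ^+ i.
  elim: i => [|i IHi]; first by rewrite perm1 mulg1.
  by rewrite !expgSr permM IHi permE mulgA.
apply/setP => z; apply/porbitP/lcosetP => [[i ->]|[_ /cycleP[i ->] ->]].
  by exists (x ^+ i); rewrite ?mem_cycle.
by exists i.
Qed.

Lemma cycle_type_rect n (s : 'S_n) a b : (0 < b)%N -> n = (a * b)%N ->
  (forall x, #|porbit s x| = b) -> cycle_type s = nseq a b.
Proof.
move=> b_gt0 def_n card_s.
have /and3P[_ _ /eqP sum_s] := cycle_type_is_intpart s.
have /all_pred1P def_s : all (pred1 b) (cycle_type s).
  by apply/allP => k /mem_cycle_type[x ->] /=; rewrite card_s.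
rewrite def_s; congr nseq; apply/eqP; rewrite -(eqn_pmul2r b_gt0) -def_n.
by rewrite mulnC -sumn_nseq -def_s sum_s.
Qed.

(** In Z/(ab) the element a has order b, so translation by it has a cycles of
    length b. *)
Lemma cycle_type_rect_exists a b : (0 < a)%N -> (0 < b)%N ->
  exists s : 'S_(a * b), cycle_type s = nseq a b.
Proof.
move=> a_gt0 b_gt0; have n_gt0 : (0 < a * b)%N by rewrite muln_gt0 a_gt0.
case def_n: (a * b)%N n_gt0 => [//|n] _.
pose x : 'I_n.+1 := Zp1 ^+ a.
exists (perm (mulIg x)); apply: cycle_type_rect => // y.
rewrite porbit_mulr card_lcoset -[LHS]/#[x] orderXdiv order_Zp1 -def_n.
  by rewrite mulKn.
exact: dvdn_mulr.
Qed.

End CycleTypes.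

Import GRing.Theory Num.Theory.
Local Open Scope ring_scope.

(** * Divisor sums of the Moebius function *)

Lemma moebius_dvd_sqr p d : prime p -> (0 < d)%N -> (p ^ 2 %| d)%N ->
  moebius d = 0.
Proof.
move=> p_pr d_gt0 p2d; have := p2d; rewrite pfactor_dvdn // => lt1.
rewrite /moebius; case: allP => // sqf; have /sqf/eqP d1 : p \in primes d.
  by rewrite mem_primes p_pr d_gt0 (dvdn_trans _ p2d) // dvdn_exp.
by rewrite d1 in lt1.
Qed.

Lemma moebius_prime_mul p d : prime p -> (0 < d)%N -> ~~ (p %| d)%N ->
  moebius (p * d) = - moebius d.
Proof.
move=> p_pr d_gt0 pNd; have p_gt0 := prime_gt0 p_pr.
have primes_pd : perm_eq (primes (p * d)) (p :: primes d).
  apply: uniq_perm; rewrite /= ?primes_uniq ?andbT //.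
    by rewrite mem_primes p_pr d_gt0.
  by move=> q; rewrite primesM // primes_prime // !inE.
rewrite /moebius (perm_all _ primes_pd) (perm_size primes_pd) /=.
have lognp q : logn q (p * d) = ((p == q) + logn q d)%N.
  by rewrite lognM // logn_prime // eq_sym.
have -> : logn p (p * d) = 1%N.
  by rewrite lognp eqxx logn_coprime // prime_coprime.
rewrite eqxx /= (eq_in_all (a2 := fun q => logn q d == 1%N)); last first.
  move=> q; rewrite mem_primes => /and3P[_ _ qd]; rewrite lognp.
  by case: (p =P q) => // def_p; rewrite def_p qd in pNd.
by case: ifP; rewrite ?oppr0 // exprS mulN1r.
Qed.

(** Only the divisors d of p^(k+1) m with p^2 not dividing d contribute, and they
    are the d and the p d for d | m; mu changes sign from d to p d.  Whatever F is,
    this strips one prime from a Moebius sum: for F = 1 nothing is left, and for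
    F(d) = n / d the sum is reduced to one over m. *)
Lemma sum_moebius_split (F : nat -> rat) p k m :
    prime p -> (0 < m)%N -> ~~ (p %| m)%N ->
  \sum_(d <- divisors (p ^ k.+1 * m)) moebius d * F d =
    \sum_(d <- divisors m) moebius d * (F d - F (p * d)%N).
Proof.
move=> p_pr m_gt0 pNm; have p_gt0 := prime_gt0 p_pr.
have N_gt0 : (0 < p ^ k.+1 * m)%N by rewrite muln_gt0 expn_gt0 p_gt0.
rewrite (bigID (fun d => p ^ 2 %| d)%N) /= big_seq_cond big1 ?add0r; last first.
  move=> d /andP[]; rewrite -dvdn_divisors // => dN p2d.
  by rewrite (moebius_dvd_sqr p_pr) ?mul0r // (dvdn_gt0 N_gt0).
rewrite -big_filter.
(* The divisors of p^(k+1) m that p^2 does not divide, listed in two families. *)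
rewrite (perm_big (divisors m ++ [seq (p * d)%N | d <- divisors m])) /=.
  rewrite big_cat /= big_map -big_split /= big_seq [RHS]big_seq.
  apply: eq_bigr => d; rewrite -dvdn_divisors // => dm.
  have d_gt0 := dvdn_gt0 m_gt0 dm.
  rewrite moebius_prime_mul ?mulNr ?mulrBr //.
  by apply: contra pNm => /dvdn_trans; apply.
have pNd d : (d %| m)%N -> ~~ (p %| d)%N.
  by move=> dm; apply: contra pNm => /dvdn_trans; apply.
apply: uniq_perm.
- by rewrite filter_uniq ?divisors_uniq.
- rewrite cat_uniq divisors_uniq map_inj_uniq ?divisors_uniq ?andbT /=.
    apply/hasPn => _ /mapP[d _ ->] /=; rewrite -dvdn_divisors //.
    by apply/negP => /pNd; rewrite dvdn_mulr.
  by move=> d e /eqP; rewrite eqn_pmul2l // => /eqP.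
move=> d; rewrite mem_filter mem_cat -!dvdn_divisors //.
apply/andP/orP => [[p2Nd dN]|[dm|/mapP[e]]].
- have [/dvdnP[e def_d]|pd] := boolP (p %| d)%N; last first.
    left; rewrite -(Gauss_dvdr _ (n := p ^ k.+1)) // coprimeXr //.
    by rewrite coprime_sym prime_coprime.
  right; apply/mapP; exists e; last by rewrite mulnC.
  move: dN p2Nd; rewrite def_d expnSr -mulnn mulnAC !dvdn_pmul2r // => eN pe.
  rewrite -dvdn_divisors // -(Gauss_dvdr _ (n := p ^ k)) //.
  by rewrite coprimeXr // coprime_sym prime_coprime.
- split; last by rewrite dvdn_mull.
  by apply: contra (pNd _ dm); apply: dvdn_trans; rewrite dvdn_exp.
rewrite -dvdn_divisors // => em ->.
rewrite -mulnn dvdn_pmul2l // pNd //.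
by rewrite expnS -mulnA dvdn_pmul2l // dvdn_mull.
Qed.

Lemma prime_factor_out n : (1 < n)%N ->
  exists p k m, [/\ prime p, (0 < m)%N, ~~ (p %| m)%N & n = (p ^ k.+1 * m)%N].
Proof.
move=> n_gt1; have n_gt0 := ltnW n_gt1; have p_pr := pdiv_prime n_gt1.
have [m pm def_n] := pfactor_coprime p_pr n_gt0.
exists (pdiv n), (logn (pdiv n) n).-1, m; split=> //.
- by move: n_gt0; rewrite {1}def_n muln_gt0 => /andP[].
- by rewrite -prime_coprime.
rewrite prednK ?[LHS]def_n 1?mulnC //.
by rewrite logn_gt0 mem_primes p_pr n_gt0 pdiv_dvd.
Qed.

Lemma sum_moebius_divisors n : (1 < n)%N ->
  \sum_(d <- divisors n) moebius d = 0.
Proof.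
move=> /prime_factor_out[p [k [m [p_pr m_gt0 pNm ->]]]].
transitivity (\sum_(d <- divisors (p ^ k.+1 * m)) moebius d * 1).
  by apply: eq_bigr => d _; rewrite mulr1.
rewrite (sum_moebius_split (fun=> 1)) //.
by rewrite big1 // => d _; rewrite subrr mulr0.
Qed.

(** Stripping the prime p multiplies the sum by p^(k+1) - p^k = phi(p^(k+1)), so
    the sum obeys the product formula of the totient. *)
Lemma sum_moebius_totient n : (0 < n)%N ->
  \sum_(d <- divisors n) moebius d * (n %/ d)%:R = (totient n)%:R.
Proof.
elim/ltn_ind: n => n IHn n_gt0; have [le_n1|] := leqP n 1.
  by rewrite (_ : n = 1%N) ?big_seq1 //; apply/eqP; rewrite eqn_leq le_n1.
case/prime_factor_out=> p [k [m [p_pr m_gt0 pNm def_n]]].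
have p_gt0 := prime_gt0 p_pr.
have copm : coprime (p ^ k.+1) m by rewrite coprimeXl // prime_coprime.
rewrite def_n (sum_moebius_split (fun d => (p ^ k.+1 * m %/ d)%:R)) //.
rewrite totient_coprime // totient_pfactor // natrM -IHn //; last first.
  rewrite def_n -{1}[m]mul1n ltn_pmul2r // -(exp1n k.+1) ltn_exp2r //.
  exact: prime_gt1.
rewrite mulr_sumr big_seq [RHS]big_seq; apply: eq_bigr => d.
rewrite -dvdn_divisors // => dm; have d_gt0 := dvdn_gt0 m_gt0 dm.
rewrite mulrCA; congr (_ * _); rewrite -natrM.
rewrite expnS -[(p * p ^ k * m)%N]mulnA divnMl // -!muln_divA ?dvdn_mull //.
rewrite -{1}[p]prednK // !natrM -[p.-1.+1]addn1 natrD.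
by rewrite mulrDl mul1r addrK mulrA.
Qed.

(** * Values and derivatives at 1 of cycle polynomials *)

(** This turns cancelling the factor X - c and then evaluating at c into taking
    a derivative. *)
Lemma divp_XsubC_root_horner (F : fieldType) (p : {poly F}) c :
  root p c -> (p %/ ('X - c%:P)).[c] = p^`().[c].
Proof.
case/factor_theorem=> q ->; rewrite mulpK ?polyXsubC_eq0 //.
by rewrite derivM derivXsubC !hornerE subrr mulr0 add0r.
Qed.

Lemma deriv_mul_root_horner (R : comNzRingType) (p q : {poly R}) c :
  p.[c] = 0 -> (p * q)^`().[c] = p^`().[c] * q.[c].
Proof. by move=> pc0; rewrite derivM !hornerE pc0 mul0r addr0. Qed.

Lemma horner_necklace m : (1 < m)%N -> (necklace_poly m).[1] = 0.
Proof.
move=> m_gt1; rewrite /necklace_poly hornerZ horner_sum.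
rewrite (eq_bigr moebius) => [|d _]; last first.
  by rewrite hornerZ hornerXn expr1n mulr1.
by rewrite sum_moebius_divisors ?mulr0.
Qed.

Lemma deriv_necklace m : (0 < m)%N ->
  (necklace_poly m)^`().[1] = (totient m)%:R / m%:R.
Proof.
move=> m_gt0; rewrite /necklace_poly derivZ hornerZ raddf_sum horner_sum mulrC.
congr (_ * _); rewrite -sum_moebius_totient //; apply: eq_bigr => d _.
by rewrite /= derivZ hornerZ derivXn hornerMn hornerXn expr1n.
Qed.

Lemma necklace1 : necklace_poly 1 = 'X.
Proof. by rewrite /necklace_poly big_seq1 /moebius /= invr1 !scale1r. Qed.

Lemma binom_poly0 t : binom_poly t 0 = 1.
Proof. by rewrite /binom_poly big_ord0 invr1 scale1r. Qed.

(** The product of the factors t - i of a binomial that remain beside a vanishing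
    one: those with i >= 1 where t = 0, those with i >= 2 where t = 1. *)
Lemma prod_opp_fact k : \prod_(i < k) - (i.+1%:R : rat) = (-1) ^+ k * k`!%:R.
Proof.
elim: k => [|k IHk]; first by rewrite big_ord0 mulr1.
by rewrite big_ord_recr IHk /= exprS factS natrM; ring.
Qed.

Lemma fact_neq0 k : k`!%:R != 0 :> rat.
Proof. by rewrite pnatr_eq0 -lt0n fact_gt0. Qed.

Lemma binom_poly_root0 t c k : t.[c] = 0 -> (binom_poly t k.+1).[c] = 0.
Proof.
by move=> tc; rewrite hornerZ big_ord_recl subr0 hornerM tc mul0r mulr0.
Qed.

Lemma deriv_binom_poly_root0 t c k : t.[c] = 0 ->
  (binom_poly t k.+1)^`().[c] = (-1) ^+ k * t^`().[c] / k.+1%:R.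
Proof.
move=> tc; rewrite derivZ hornerZ big_ord_recl subr0 deriv_mul_root_horner //.
rewrite horner_prod (eq_bigr (fun i : 'I_k => - (i.+1%:R))) => [|i _]; last first.
  by rewrite hornerD hornerN -polyC_natr hornerC tc sub0r.
rewrite prod_opp_fact factS natrM; have f0 := fact_neq0 k.
by field; rewrite f0 -(natrD _ 1) pnatr_eq0.
Qed.

(** At t = 1 it is the second factor of t (t - 1) (t - 2) ... that vanishes, so
    it is moved to the front. *)
Lemma binomX_factor k :
  binom_poly 'X k.+2 =
    ('X - 1%:P) * (k.+2`!%:R^-1 *: ('X * \prod_(i < k) ('X - i.+2%:R))).
Proof.
by rewrite /binom_poly big_ord_recl subr0 big_ord_recl mulrCA scalerAr.
Qed.

Lemma binomX_root1 k : (binom_poly 'X k.+2).[1] = 0.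
Proof. by rewrite binomX_factor hornerM hornerXsubC subrr mul0r. Qed.

Lemma deriv_binomX_root1 k :
  (binom_poly 'X k.+2)^`().[1] = (-1) ^+ k / (k.+2%:R * k.+1%:R).
Proof.
rewrite binomX_factor deriv_mul_root_horner ?hornerXsubC ?subrr //.
rewrite derivXsubC hornerC mul1r hornerZ hornerM hornerX mul1r.
rewrite horner_prod (eq_bigr (fun i : 'I_k => - (i.+1%:R))) => [|i _]; last first.
  by rewrite -polyC_natr hornerXsubC -[i.+2%:R]natr1 opprD addrCA subrr addr0.
rewrite prod_opp_fact !factS !natrM; have f0 := fact_neq0 k.
by rewrite !invfM mulrCA -!mulrA mulVf // mulr1 mulrC.
Qed.

Lemma cycle_poly_rect a b : (0 < a)%N -> (0 < b)%N ->
  cycle_poly (a * b) (nseq a b) = binom_poly (necklace_poly b) a.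
Proof.
move=> a_gt0 b_gt0; rewrite /cycle_poly.
rewrite (bigD1_seq b) ?mem_index_iota ?iota_uniq //=; last first.
  by rewrite b_gt0 ltnS leq_pmull.
rewrite big1 ?mulr1 => [|j jNb]; first by rewrite count_nseq /= eqxx mul1n.
by rewrite count_nseq /= eq_sym (negPf jNb) binom_poly0.
Qed.

Lemma splitting_mass_rect n a b : (0 < a)%N -> (1 < b)%N -> n = (a * b)%N ->
  splitting_mass n (nseq a b) = (-1) ^+ a.+1 * ((totient b)%:R / n%:R).
Proof.
move=> a_gt0 b_gt1 ->; have b_gt0 := ltnW b_gt1.
rewrite /splitting_mass cycle_poly_rect // hornerXn expr1n divr1 -polyC1.
case: a a_gt0 => // a _; have Mb0 := horner_necklace b_gt1.
rewrite divp_XsubC_root_horner; last by rewrite rootE binom_poly_root0.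
rewrite deriv_binom_poly_root0 // deriv_necklace // natrM invfM.
by rewrite !exprS !mulN1r opprK; ring.
Qed.

Lemma splitting_mass_id k :
  splitting_mass k.+2 (nseq k.+2 1%N) = (-1) ^+ k / (k.+2%:R * k.+1%:R).
Proof.
rewrite /splitting_mass -{1}[k.+2]muln1 cycle_poly_rect // necklace1.
rewrite hornerXn expr1n divr1 -polyC1 divp_XsubC_root_horner.
  exact: deriv_binomX_root1.
by rewrite rootE binomX_root1.
Qed.

(** * Masses of the measures *)

(** The case distinction cannot be avoided: a list that is not the cycle type of
    any permutation has an empty class, whatever mass w gives it. *)
Lemma measure_of_class_fun n w la :
  measure_of (class_fun_of_masses n w) (cycle_class n la) =
    if cycle_class n la == set0 then 0 else w la.
Proof.
rewrite /measure_of; case: eqP => [->|/eqP]; first by rewrite big_set0.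
rewrite -card_gt0 => cl_gt0.
rewrite (eq_bigr (fun=> w la / #|cycle_class n la|%:R)) => [|g]; last first.
  by rewrite inE ffunE => /eqP->.
by rewrite sumr_const -[LHS]mulr_natr divfK // pnatr_eq0 -lt0n.
Qed.

Lemma measure_of_rect n w a b : (0 < a)%N -> (0 < b)%N -> n = (a * b)%N ->
  measure_of (class_fun_of_masses n w) (cycle_class n (nseq a b)) = w (nseq a b).
Proof.
move=> a_gt0 b_gt0 ->; have [g g_rect] := cycle_type_rect_exists a_gt0 b_gt0.
rewrite measure_of_class_fun ifN //; apply/set0Pn.
by exists g; rewrite inE g_rect.
Qed.

Lemma eq_class_fun n w1 w2 :
    (forall la, is_intpart n la -> w1 la = w2 la) ->
  class_fun_of_masses n w1 = class_fun_of_masses n w2.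
Proof.
by move=> eq_w; apply/ffunP => g; rewrite !ffunE eq_w ?cycle_type_is_intpart.
Qed.

(** The closed form of the theorem as a function of the partition: rectangles are
    the constant lists, and then a is the length and b the head. *)
Definition rect_mass (n : nat) (la : seq nat) : rat :=
  if constant la
  then (-1) ^+ (size la).+1 * ((totient (head 0%N la))%:R / n%:R)
  else 0.

Lemma rect_mass_nseq n a b : (0 < a)%N ->
  rect_mass n (nseq a b) = (-1) ^+ a.+1 * ((totient b)%:R / n%:R).
Proof.
by move=> a_gt0; rewrite /rect_mass constant_nseq size_nseq; case: a a_gt0.
Qed.

Lemma constant_intpart n la : (0 < n)%N -> is_intpart n la -> constant la ->
  exists a b, [/\ (0 < a)%N, (0 < b)%N, n = (a * b)%N & la = nseq a b].
Proof.
move=> n_gt0 /and3P[_ _ /eqP def_n] la_const.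
have def_la : la = nseq (size la) (head 0%N la).
  by case: {def_n} la la_const => //= b la /all_pred1P {1}->.
exists (size la), (head 0%N la).
move: n_gt0; rewrite -def_n {1}def_la sumn_nseq muln_gt0 => /andP[-> ->].
by split=> //; rewrite {1}def_la sumn_nseq mulnC.
Qed.

Lemma is_nontrivial_rectP n la : (0 < n)%N ->
  reflect (exists a b, [/\ (0 < a)%N, (1 < b)%N, n = (a * b)%N & la = nseq a b])
          (is_nontrivial_rect n la).
Proof.
move=> n_gt0; apply: (iffP hasP) => [[b]|[a [b [a_gt0 b_gt1 def_n ->]]]].
  rewrite -dvdn_divisors // => bn /andP[b_gt1 /eqP->]; exists (n %/ b)%N, b.
  by rewrite divnK // divn_gt0 ?(ltnW b_gt1) // dvdn_leq.
have b_gt0 := ltnW b_gt1; exists b.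
  by rewrite -dvdn_divisors // def_n dvdn_mull.
by rewrite b_gt1 def_n mulnK /=.
Qed.

(** Stated separately to keep [omega] folded on the right-hand side, where the
    induction hypothesis has to be rewritten. *)
Lemma omegaSS n :
  omega n.+2 = class_fun_of_masses n.+2 (fun la =>
    if is_nontrivial_rect n.+2 la then
      measure_of (splitting_measure n.+2) (cycle_class n.+2 la)
    else if la == nseq n.+2 1%N then
      measure_of (splitting_measure n.+2) (cycle_class n.+2 la)
      - measure_of (omega n.+1) (cycle_class n.+1 (nseq n.+1 1%N))
    else 0).
Proof. by []. Qed.

(** For [1^n] the induction comes down to
    1 / (n (n - 1)) - 1 / (n - 1) = - 1 / n, up to the sign (-1)^n. *)
Lemma omegaE n : (0 < n)%N -> omega n = class_fun_of_masses n (rect_mass n).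
Proof.
elim: n => // -[|n] IHn _; first (apply: eq_class_fun => la la_part /=).
  suff -> : la = nseq 1 1%N.
    by rewrite rect_mass_nseq // sqrrN expr1n mul1r divr1.
  case/and3P: la_part => _.
  by case: la => [|[|[|k]] [|[|l] la]] //=; rewrite ?inE.
have n2_gt0 : (0 < n.+2)%N by [].
rewrite omegaSS IHn //; apply: eq_class_fun => la la_part.
have [la_const|la_nconst] := boolP (constant la); last first.
  rewrite [RHS]/rect_mass (negPf la_nconst).
  case: is_nontrivial_rectP => // [[a [b [_ _ _ def_la]]]|_].
    by rewrite def_la constant_nseq in la_nconst.
  by case: eqP => // def_la; rewrite def_la (constant_nseq n.+2) in la_nconst.
have [a [b [a_gt0 b_gt0 def_n ->]]] := constant_intpart n2_gt0 la_part la_const.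
have [b_gt1|b_le1] := ltnP 1 b.
  rewrite (introT (is_nontrivial_rectP _ n2_gt0)); last by exists a, b.
  by rewrite measure_of_rect // splitting_mass_rect // rect_mass_nseq.
have b1 : b = 1%N by apply/eqP; rewrite eqn_leq b_le1.
rewrite {b b_gt0 b_le1}b1 muln1 in def_n *; rewrite -{a a_gt0}def_n eqxx.
case: is_nontrivial_rectP => // [[a [b [a_gt0 b_gt1 _ eq_rect]]]|_].
  case: a a_gt0 eq_rect => // a _ [b1]; by rewrite -b1 in b_gt1.
rewrite !measure_of_rect ?muln1 // splitting_mass_id !rect_mass_nseq //.
have -> : totient 1 = 1%N by [].
by rewrite !exprS; field; rewrite -(natrD _ 2) -(natrD _ 1) !pnatr_eq0.
Qed.

(** * Support and sign *)

(** The mass on a rectangle [b^a] never vanishes because phi(b) > 0. *)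
Lemma omega_neq0 n (g : 'S_n) : (0 < n)%N ->
  (omega n g != 0) = constant (cycle_type g).
Proof.
move=> n_gt0; rewrite omegaE // ffunE.
have [g_const|/negPf g_nconst] := boolP (constant _); last first.
  by rewrite /rect_mass g_nconst mul0r eqxx.
have card_gt0 : (0 < #|cycle_class n (cycle_type g)|)%N.
  by apply/card_gt0P; exists g; rewrite inE.
rewrite mulf_neq0 ?invr_eq0 ?pnatr_eq0 -?lt0n {card_gt0}//.
have [a [b [a_gt0 b_gt0 _ ->]]] :=
  constant_intpart n_gt0 (cycle_type_is_intpart g) g_const.
rewrite rect_mass_nseq // mulf_neq0 ?signr_eq0 // mulf_neq0 ?invr_eq0 //.
  by rewrite pnatr_eq0 -lt0n totient_gt0.
by rewrite pnatr_eq0 -lt0n.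
Qed.

Lemma support_classes_omega n : (0 < n)%N ->
  support_classes (omega n) =
    [set C in [seq cycle_class n (nseq (n %/ b) b) | b <- divisors n]].
Proof.
move=> n_gt0; apply/setP => C; rewrite !inE; apply/andP/mapP.
  case=> /imsetP[g _ ->] /exists_inP[_ /imsetP[h _ ->]].
  rewrite omega_neq0 // cycle_typeJ -cycle_class_conj => g_const.
  have [a [b [a_gt0 b_gt0 def_n ->]]] :=
    constant_intpart n_gt0 (cycle_type_is_intpart g) g_const.
  exists b; first by rewrite -dvdn_divisors // def_n dvdn_mull.
  by congr (cycle_class _ (nseq _ _)); rewrite def_n mulnK.
case=> b; rewrite -dvdn_divisors // => bn ->.
have b_gt0 := dvdn_gt0 n_gt0 bn.
have a_gt0 : (0 < n %/ b)%N by rewrite divn_gt0 // dvdn_leq.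
have [g g_rect] := cycle_type_rect_exists a_gt0 b_gt0.
rewrite divnK // in g g_rect; rewrite -g_rect; split.
  by rewrite cycle_class_conj mem_classes ?inE.
apply/exists_inP; exists g; first by rewrite inE.
by rewrite omega_neq0 // g_rect constant_nseq.
Qed.

Lemma card_support_classes_omega n : (0 < n)%N ->
  #|support_classes (omega n)| = size (divisors n).
Proof.
move=> n_gt0; rewrite support_classes_omega // cardsE.
set s := map _ _; suff /card_uniqP-> : uniq s by rewrite size_map.
rewrite map_inj_in_uniq ?divisors_uniq // => b c.
rewrite -!dvdn_divisors // => bn cn eq_class.
have b_gt0 := dvdn_gt0 n_gt0 bn.
have a_gt0 : (0 < n %/ b)%N by rewrite divn_gt0 // dvdn_leq.
have [g g_rect] := cycle_type_rect_exists a_gt0 b_gt0.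
rewrite divnK // in g g_rect.
have: g \in cycle_class n (nseq (n %/ b) b) by rewrite inE g_rect.
rewrite eq_class inE g_rect => /eqP.
by case: (n %/ b)%N a_gt0 => // k _; case: (n %/ c)%N => // l [].
Qed.

Lemma omega_ge0 n (g : 'S_n) : odd n -> 0 <= omega n g.
Proof.
move=> n_odd; have n_gt0 := odd_gt0 n_odd.
rewrite omegaE // ffunE mulr_ge0 // ?invr_ge0 ?ler0n // /rect_mass.
case: ifP => // g_const.
have [a [b [_ _ def_n ->]]] :=
  constant_intpart n_gt0 (cycle_type_is_intpart g) g_const.
move: n_odd; rewrite {1}def_n oddM => /andP[a_odd _].
rewrite size_nseq -signr_odd /= a_odd expr0 mul1r.
by rewrite mulr_ge0 // ?invr_ge0 ler0n.
Qed.

Theorem theorem3p2 (n : nat) (n_ge1 : (1 <= n)%N) :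
  [/\ forall la : seq nat, is_intpart n la ->
        (forall a b : nat, (a * b)%N = n -> la = nseq a b ->
           measure_of (omega n) (cycle_class n la)
             = (-1) ^+ a.+1 * ((totient b)%:R / n%:R))
        /\ ((forall a b : nat, (a * b)%N = n -> la <> nseq a b) ->
           measure_of (omega n) (cycle_class n la) = 0),
      #|support_classes (omega n)| = size (divisors n),
      odd n -> forall Y : {set 'S_n}, 0 <= measure_of (omega n) Y
    & ~~ odd n ->
        (exists Y : {set 'S_n}, 0 < measure_of (omega n) Y)
        /\ (exists Y : {set 'S_n}, measure_of (omega n) Y < 0)].
Proof.
have mass_rect a b : (a * b)%N = n ->
    measure_of (omega n) (cycle_class n (nseq a b))
      = (-1) ^+ a.+1 * ((totient b)%:R / n%:R).
  move=> def_n; have /andP[a_gt0 b_gt0] : (0 < a)%N && (0 < b)%N.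
    by rewrite -muln_gt0 def_n.
  by rewrite omegaE // measure_of_rect // rect_mass_nseq.
split.
- move=> la la_part; split=> [a b def_n ->|la_nrect]; first exact: mass_rect.
  rewrite omegaE // measure_of_class_fun /rect_mass; case: ifP => // _.
  case: ifP => // /(constant_intpart n_ge1 la_part)[a [b [_ _ def_n def_la]]].
  by case: (la_nrect a b).
- exact: card_support_classes_omega.
- by move=> n_odd Y; apply: sumr_ge0 => g _; exact: omega_ge0.
move=> n_even; split.
  (* The n-cycles carry positive mass, the identity negative mass. *)
  exists (cycle_class n (nseq 1 n)); rewrite mass_rect ?mul1n //.
  by rewrite sqrrN expr1n mul1r divr_gt0 ?ltr0n ?totient_gt0.
exists (cycle_class n (nseq n 1%N)); rewrite mass_rect ?muln1 //.
rewrite -signr_odd /= n_even expr1 mulN1r oppr_lt0.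
by rewrite divr_gt0 ?ltr0n ?totient_gt0.
Qed.
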